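(* Let $\mathbb{K}$ be a field of characteristic $0$, let $I\subset\mathbb{K}[x_1,\dots,x_n]$ be a $B_n$-invariant ideal and let $P\in I$ with homogeneous component of highest degree $P_d$. Let $m$ be a monomial occurring in $P_d$, written uniquely as $m=\prod_{i\in I_1}x_i^{2k_i}\prod_{i\in I_2}x_i^{2r_i+1}$ with $I_1\cap I_2=\emptyset$, $k_i\ge1$, $r_i\ge0$, and set $d_1=\sum_{i\in I_1}k_i$, $d_2=\sum_{i\in I_2}r_i$. Assume $\mathrm{wt}(P_d)+d_1+d_2\le n$. Then $I_{\Gamma^*(m)}\subset I$.
   Context: The hyperoctahedral group $B_n$ acts on $\mathbb{K}[x_1,\dots,x_n]$ by permutations of the variables and sign changes $x_i\mapsto -x_i$; an ideal $I$ is $B_n$-invariant if $\sigma f\in I$ for all $f\in I$, $\sigma\in B_n$. $\mathrm{wt}(P_d)$ is the number of variables appearing in $P_d$. With $\ell=|I_1|$, $s=|I_2|$ (note $\ell+s\le\mathrm{wt}(P_d)$, so $\ell+s+d_1+d_2\le n$): let $(\lambda_1,\dots,\lambda_\ell)$ be the $k_i$ sorted non-increasingly and $(\mu_1,\dots,\mu_s)$ the $r_i$ sorted non-increasingly; define $\tilde\lambda=(\lambda_1+1,\dots,\lambda_\ell+1,1,\dots,1)$ with $n-(\ell+s+d_1+d_2)$ trailing ones, $\tilde\mu=(\mu_1+1,\dots,\mu_s+1)$, and $\Gamma^*(m)=(\tilde\lambda^\perp,\tilde\mu^\perp)$, where $\perp$ denotes the conjugate partition (transpose Young diagram); this is a bipartition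 of $n$. For a bipartition $(\alpha,\beta)$ of $n$ (pair of partitions with $|\alpha|+|\beta|=n$), a bitableau of shape $(\alpha,\beta)$ is a filling of the pair of Young diagrams with $1,\dots,n$ each once; with $\Delta_{(i_1,\dots,i_r)}(\mathbf{y})=\prod_{j<k}(y_{i_j}-y_{i_k})$, its Specht polynomial is $\mathrm{sp}_{(T,S)}(\mathbf{x})=\prod_i\Delta_{T_i}(\mathbf{x}^2)\prod_j\Delta_{S_j}(\mathbf{x}^2)\prod_{k\in S}x_k$ ($T_i,S_j$ columns read top to bottom, $\mathbf{x}^2=(x_1^2,\dots,x_n^2)$), and $I_{(\alpha,\beta)}$ is the ideal generated by all Specht polynomials of bitableaux of shape $(\alpha,\beta)$. *)

(* Defs.v *)
From mathcomp Require Import all_boot all_order all_fingroup all_algebra.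
From mathcomp Require Import mpoly.

Set Implicit Arguments.
Unset Strict Implicit.
Unset Printing Implicit Defensive.

Import GRing.Theory.
Local Open Scope ring_scope.

(* Ideals are Prop-valued predicates, since the library's [idealr] are decidable
   and exclude the whole ring. *)
Definition is_ideal (R : comNzRingType) (J : R -> Prop) : Prop :=
  [/\ J 0, forall f g, J f -> J g -> J (f + g)
    & forall a f, J f -> J (a * f)].

Definition ideal_gen (R : comNzRingType) (G : R -> Prop) (f : R) : Prop :=
  forall J : R -> Prop, is_ideal J -> (forall g, G g -> J g) -> J f.

Section Hyperoctahedral.
Variables (K : fieldType) (n : nat).
Implicit Types (f p : {mpoly K[n]}).

(* An element of B_n is a pair of a permutation s and a choice e of signs; it
   acts by the substitution x_i |-> (-1)^(e i) x_(s i). *)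
Definition signed_act (s : 'S_n) (e : {ffun 'I_n -> bool}) f : {mpoly K[n]} :=
  f \mPo [tuple (-1) ^+ e i * 'X_(s i) | i < n].

Definition Bn_invariant (I : {mpoly K[n]} -> Prop) : Prop :=
  forall (s : 'S_n) (e : {ffun 'I_n -> bool}) f, I f -> I (signed_act s e f).

(* [msize p] is 1 + deg p. *)
Definition top_homog p : {mpoly K[n]} := pihomog mdeg (msize p).-1 p.

Definition wt p : nat :=
  #|[set i : 'I_n | has (fun m : 'X_{1..n} => 0 < m i)%N (msupp p)]|.

End Hyperoctahedral.

Definition is_part (lam : seq nat) : bool := sorted geq lam && (0%N \notin lam).

Definition is_bipart (n : nat) (ab : seq nat * seq nat) : bool :=
  [&& is_part ab.1, is_part ab.2 & (sumn ab.1 + sumn ab.2 == n)%N].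

(* The j-th part of the conjugate is the length of the j-th column. *)
Definition conj_part (lam : seq nat) : seq nat :=
  [seq count (fun x => j < x)%N lam | j <- iota 0 (head 0%N lam)].

Section GammaStar.
Variables (n : nat) (I1 I2 : {set 'I_n}) (k r : 'I_n -> nat).

Definition lambda_tilde : seq nat :=
  [seq x.+1 | x <- sort geq [seq k i | i <- enum I1]]
    ++ nseq (n - (#|I1| + #|I2| + \sum_(i in I1) k i + \sum_(i in I2) r i)) 1%N.

Definition mu_tilde : seq nat :=
  [seq x.+1 | x <- sort geq [seq r i | i <- enum I2]].

(* The data I1, I2, k, r are those of the factorisation of the monomial m. *)
Definition Gamma_star : seq nat * seq nat :=
  (conj_part lambda_tilde, conj_part mu_tilde).

End GammaStar.

Section Specht.
Variables (K : fieldType) (n : nat).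

Definition Delta (R : comNzRingType) (s : seq 'I_n) (y : 'I_n -> R) : R :=
  \prod_(j < size s) \prod_(k < size s | (j < k)%N)
    (y (tnth (in_tuple s) j) - y (tnth (in_tuple s) k)).

(* A tableau is the list of its rows, from top to bottom. The entries
   1, ..., n are represented by the elements of 'I_n. *)
Definition tableau := seq (seq 'I_n).

Definition is_bitableau (ab : seq nat * seq nat) (TS : tableau * tableau) : bool :=
  [&& shape TS.1 == ab.1, shape TS.2 == ab.2
    & perm_eq (flatten TS.1 ++ flatten TS.2) (enum 'I_n)].

Definition columns (T : tableau) : seq (seq 'I_n) :=
  [seq pmap (fun row => onth row j) T | j <- iota 0 (size (head [::] T))].

Definition specht (TS : tableau * tableau) : {mpoly K[n]} :=
  let x2 := fun i : 'I_n => 'X_i ^+ 2 : {mpoly K[n]} in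
  \prod_(c <- columns TS.1) Delta c x2 * \prod_(c <- columns TS.2) Delta c x2
    * \prod_(i <- flatten TS.2) 'X_i.

Definition specht_ideal (ab : seq nat * seq nat) : {mpoly K[n]} -> Prop :=
  ideal_gen (fun g => exists2 TS, is_bitableau ab TS & g = specht TS).

End Specht.

Lemma conj_part_is_part lam : is_part (conj_part lam).
Proof.
apply/andP; split; last first.
  apply/mapP=> -[j]; rewrite mem_iota /= add0n => ltj /eqP.
  rewrite eq_sym -leqn0 leqNgt -has_count => /negP[].
  by case: lam ltj => [|x lam] //= ->.
rewrite /conj_part sorted_map.
apply: (sub_sorted _ (iota_ltn_sorted 0 _)) => i j /= ltij.
by apply: sub_count => x /=; apply: ltn_trans.
Qed.

Lemma sumn_conj_part lam : is_part lam -> sumn (conj_part lam) = sumn lam.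
Proof.
case/andP=> srt _.
have le_head : {in lam, forall x, (x <= head 0%N lam)%N}.
  case: lam srt => [|y lam] //= srt x; rewrite inE => /predU1P[->|] //.
  have gt : transitive geq by move=> a b c /= ha hc; apply: leq_trans hc ha.
  by move: (order_path_min gt srt) => /allP /(_ x).
rewrite /conj_part; move: (head _ _) le_head => h {srt}.
elim: lam => [|x lam IH] le_h /=.
  by elim: (iota 0 h).
rewrite -IH => [|y ylam]; last by rewrite le_h ?inE ?ylam ?orbT.
have /subnKC hE := le_h x (mem_head _ _).
have -> s : sumn [seq ((j < x) + count (fun x => j < x) lam)%N | j <- s]
          = (count (ltn^~ x) s + sumn [seq count (fun x => j < x)%N lam | j <- s])%N.
  by elim: s => //= j s ->; rewrite addnACA.
congr (_ + _)%N; rewrite -hE iotaD count_cat.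
rewrite [X in (X + _)%N](eq_in_count (a2 := xpredT)); last first.
  by move=> j; rewrite mem_iota add0n => /andP[_ /= ->].
rewrite [X in (_ + X)%N](eq_in_count (a2 := xpred0)); last first.
  by move=> j; rewrite mem_iota add0n => /andP[/leq_gtF /= ->].
by rewrite count_predT count_pred0 size_iota addn0.
Qed.

Lemma is_part_succ lam p :
  sorted geq lam -> is_part ([seq x.+1 | x <- lam] ++ nseq p 1%N).
Proof.
move=> srt; apply/andP; split; last first.
  by rewrite mem_cat mem_nseq andbF orbF; apply/mapP=> -[].
have gt : transitive geq by move=> a b c /= ha hc; apply: leq_trans hc ha.
rewrite sorted_pairwise // pairwise_cat pairwise_map -!sorted_pairwise //.
apply/and3P; split.
- apply/allrelP=> _ y /mapP[x _ ->]; rewrite mem_nseq => /andP[_ /eqP ->].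
  by [].
- by rewrite (eq_sorted (e' := geq)).
- by elim: p => // -[|p] //= ->.
Qed.

Lemma sumn_succ lam : sumn [seq x.+1 | x <- lam] = (size lam + sumn lam)%N.
Proof. by elim: lam => //= x lam ->; rewrite addSn addnCA !addnA. Qed.

Lemma Gamma_star_bipart n (I1 I2 : {set 'I_n}) (k r : 'I_n -> nat) :
  (#|I1| + #|I2| + \sum_(i in I1) k i + \sum_(i in I2) r i <= n)%N ->
  is_bipart n (Gamma_star I1 I2 k r).
Proof.
move=> le_n.
have srt s : sorted geq (sort geq s) by apply: sort_sorted => x y; apply: leq_total.
have sumE (A : {set 'I_n}) (f : 'I_n -> nat) :
    sumn [seq x.+1 | x <- sort geq [seq f i | i <- enum A]]
    = (#|A| + \sum_(i in A) f i)%N.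
  rewrite sumn_succ size_sort size_map -cardE; congr (_ + _)%N.
  rewrite -big_enum -[RHS](big_map f xpredT id) -sumnE; apply: perm_sumn.
  by rewrite perm_sort.
have part1 : is_part (lambda_tilde I1 I2 k r) by apply: is_part_succ.
have part2 : is_part (mu_tilde I2 r).
  by have := is_part_succ 0 (srt [seq r i | i <- enum I2]); rewrite cats0.
rewrite /is_bipart !conj_part_is_part !sumn_conj_part //=; apply/eqP.
rewrite /lambda_tilde /mu_tilde sumn_cat !sumE sumn_nseq mul1n.
rewrite addnAC [X in (X + _)%N]addnACA addnA.
exact: subnKC.
Qed.

(* Main.v *)
Require Import Defs.
From mathcomp Require Import all_boot all_order all_fingroup all_algebra.
From mathcomp Require Import mpoly.
From mathcomp Require Import zify.

(* Multiply P by a monomial M in variables foreign to P_d so that m * M is, after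
   renaming variables, X^e, where e fills each column of height h of the bitableau
   with 0, 2, ..., 2(h-1) (first tableau) or 1, 3, ..., 2h-1 (second tableau), the
   largest exponent at the head of the column. Project M * P on the monomials
   whose exponents are odd exactly on the second tableau, and antisymmetrise along
   every column. A monomial survives only if its exponents are pairwise distinct
   on each column, and e has the smallest degree among the exponents with these
   properties. Since m has maximal degree in P, a survivor has the degree of e,
   so it comes from P_d and agrees with M away from the heads of the columns,
   hence is X^e. What remains is the coefficient of m times a product of
   Vandermonde determinants, the Specht polynomial up to sign. *)

Set Implicit Arguments.
Unset Strict Implicit.
Unset Printing Implicit Defensive.

Import GRing.Theory.
Local Open Scope ring_scope.

(** * Preliminaries on lists: extending bijections, sums of distinct integers *)

(** Complete both lists to enumerations of [T] by appending the missing elements in a fixed order,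
    and match positions. If [a] and [b] have the same elements, the appended tails coincide, so
    nothing moves outside [a]. *)
Lemma perm_map_seq (T : finType) (a b : seq T) :
  uniq a -> uniq b -> size a = size b ->
  exists s : {perm T},
    map s a = b /\ (a =i b -> forall x, x \notin a -> s x = x).
Proof.
move=> ua ub eqab.
pose ext c := c ++ [seq x <- enum T | x \notin c].
have uext c : uniq c -> uniq (ext c).
  move=> uc; rewrite cat_uniq uc filter_uniq ?enum_uniq // andbT.
  by apply/hasPn=> x; rewrite mem_filter => /andP[].
have mext c x : x \in ext c.
  by rewrite mem_cat mem_filter mem_enum andbT orbN.
have sext c : uniq c -> size (ext c) = #|T|.
  move=> uc; rewrite cardE; apply/perm_size/uniq_perm; rewrite ?uext ?enum_uniq //.
  by move=> x; rewrite mext mem_enum.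
pose f x := nth x (ext b) (index x (ext a)).
have lt x : (index x (ext a) < size (ext b))%N by rewrite sext // -(sext a) // index_mem.
have f_inj : injective f.
  move=> x y; rewrite /f (set_nth_default y) // => /eqP.
  rewrite nth_uniq ?uext // => /eqP eqi.
  by rewrite -(nth_index x (mext a x)) eqi (set_nth_default y) ?nth_index ?index_mem.
exists (perm f_inj); split.
  case a0: {1}a => [|x0 a'].
    by move: eqab; rewrite a0; case: (b).
  rewrite -[x0 :: a']a0.
  apply: (@eq_from_nth _ x0); rewrite ?size_map // => i lti.
  rewrite (nth_map x0) // permE /f index_cat mem_nth // index_uniq //.
  by rewrite nth_cat -eqab lti; apply: set_nth_default; rewrite -eqab.
move=> eqm x xa; rewrite permE /f index_cat (negPf xa) nth_cat eqab.
rewrite ltnNge leq_addr /= addKn.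
rewrite (_ : [seq x <- enum T | x \notin b] = [seq x <- enum T | x \notin a]).
  by rewrite nth_index // mem_filter xa mem_enum.
by apply: eq_filter => y; rewrite eqm.
Qed.

Lemma leq_sum_uniq (s : seq nat) :
  uniq s -> (\sum_(i < size s) i <= \sum_(i <- s) i)%N.
Proof.
have [h] := ubnP (size s); elim: h s => // h IH [|y s'] //; rewrite ?big_ord0 //.
set s := y :: s' => lt_s us.
(* Pigeonhole: [size s] distinct integers cannot all lie below [size s']. Removing this large
   element leaves a list for the induction. *)
have [x xs le_x] : exists2 x, x \in s & (size s' <= x)%N.
  apply/hasP; rewrite -[has _ _]negbK -all_predC; apply/negP=> /allP lt.
  have /(uniq_leq_size us) : {subset s <= iota 0 (size s')}.
    by move=> x /lt /=; rewrite mem_iota -ltnNge.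
  by rewrite size_iota ltnn.
rewrite (perm_big _ (perm_to_rem xs)) big_cons /= addnC.
rewrite big_ord_recr leq_add //=.
have szr : size (rem x s) = size s' by rewrite size_rem.
by rewrite -szr; apply: IH; rewrite ?rem_uniq // szr.
Qed.

Lemma big_index (T : eqType) (c : seq T) (F : nat -> nat) :
  uniq c -> (\sum_(x <- c) F (size c - (index x c).+1) = \sum_(i < size c) F i)%N.
Proof.
move=> uc; rewrite big_tnth [RHS](reindex_inj rev_ord_inj).
by apply: eq_bigr => i _; rewrite (tnth_nth (tnth (in_tuple c) i)) index_uniq.
Qed.

Lemma flatten_uniq_mem (T : eqType) (cs : seq (seq T)) c1 c2 x :
  uniq (flatten cs) -> c1 \in cs -> c2 \in cs -> x \in c1 -> x \in c2 -> c1 = c2.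
Proof.
elim: cs => //= c cs IH; rewrite cat_uniq => /and3P[uc /hasPn dis ucs].
have nc c' : c' \in cs -> x \in c' -> x \in c -> False.
  move=> c'cs xc'; apply/negP/dis/flattenP; by exists c'.
rewrite !inE => /predU1P[->|c1cs] /predU1P[->|c2cs] // xc1 xc2.
- by case: (nc _ c2cs xc2 xc1).
- by case: (nc _ c1cs xc1 xc2).
- exact: IH.
Qed.

(** * Minimality of the column exponents *)

Section Columns.
Variable n : nat.
Implicit Types (cs : seq (seq 'I_n)) (S : {set 'I_n}) (w : 'X_{1..n}).

Lemma mdeg_columns cs w :
  uniq (flatten cs) -> flatten cs =i predT ->
  mdeg w = (\sum_(c <- cs) \sum_(x <- c) w x)%N.
Proof.
move=> ucs allcs; rewrite mdegE -big_flatten /= [RHS]big_uniq //=.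
by apply: eq_bigl => x; rewrite allcs.
Qed.

Definition column_exponent S (c : seq 'I_n) x :=
  (2 * (size c - (index x c).+1) + (x \in S))%N.

Lemma ex_column_exponent cs S : uniq (flatten cs) ->
  exists w, {in cs, forall c, {in c, forall x, w x = column_exponent S c x}}.
Proof.
elim: cs => [_|c cs IH /=]; first by exists 0%MM.
rewrite cat_uniq => /and3P[uc /hasPn dis /IH[w wE]].
exists [multinom if x \in c then column_exponent S c x else w x | x < n].
move=> c' /predU1P[->|c'cs] x xc'; rewrite mnmE; first by rewrite xc'.
rewrite ifN; first exact: wE.
by apply: dis; apply/flattenP; exists c'.
Qed.

(** The sum of [e] over each column is a lower bound for that of [w]. The degree bound turns all
    these inequalities into equalities, and agreement below the head then forces agreement at the
    head. *)
Lemma column_exponent_min cs S (w e : 'X_{1..n}) (heads : seq 'I_n) :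
  uniq (flatten cs) -> flatten cs =i predT ->
  map ohead cs = map some heads ->
  {in cs, forall c, {in c, forall x, e x = column_exponent S c x}} ->
  (forall x, odd (w x) = (x \in S)) ->
  {in cs, forall c, {in c &, injective w}} ->
  {in cs, forall c, {in c &, forall x y, (x \in S) = (y \in S)}} ->
  (mdeg w <= mdeg e)%N ->
  (mdeg w = mdeg e -> forall x, x \notin heads -> w x = e x) ->
  w = e.
Proof.
move=> ucs allcs headsE eE wS winj cS lew eqw.
have uc c : c \in cs -> uniq c.
  move=> ccs; case/splitPr: ccs ucs => cs1 cs2.
  by rewrite flatten_cat /= !cat_uniq => /and3P[_ _ /andP[]].
(* Parity is constant on [c], so the halves of the distinct values of [w] are distinct and
   [leq_sum_uniq] applies to them. *)
have le_c c : c \in cs -> (\sum_(x <- c) e x <= \sum_(x <- c) w x)%N.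
  move=> ccs; rewrite big_seq (eq_bigr _ (eE c ccs)) -big_seq big_split /=.
  rewrite -big_distrr /= (big_index id) ?uc //.
  rewrite [X in (_ <= X)%N](eq_bigr (fun x => 2 * (w x)./2 + (x \in S))%N); last first.
    by move=> x _; rewrite -wS addnC mul2n odd_double_half.
  rewrite [X in (_ <= X)%N]big_split leq_add2r -big_distrr /= leq_pmul2l //.
  have := @leq_sum_uniq [seq (w x)./2 | x <- c].
  rewrite size_map big_map; apply; rewrite map_inj_in_uniq ?uc //.
  move=> x y xc yc eqxy; apply: (winj c) => //.
  by rewrite -[w x]odd_double_half -[w y]odd_double_half eqxy !wS (cS c ccs x y xc yc).
move: lew eqw; rewrite !(mdeg_columns _ ucs allcs) => lew eqw.
have eqd : (\sum_(c <- cs) \sum_(x <- c) w x = \sum_(c <- cs) \sum_(x <- c) e x)%N.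
  apply/eqP; rewrite eqn_leq lew big_seq [X in (_ <= X)%N]big_seq /=.
  exact: leq_sum.
have eq_c c : c \in cs -> (\sum_(x <- c) w x = \sum_(x <- c) e x)%N.
  move=> ccs; apply/eqP; rewrite eqn_leq le_c // andbT.
  have := eqd; rewrite !(perm_big _ (perm_to_rem ccs)) /= !big_cons => eqr.
  move: eqr => /= eqr.
  rewrite -(leq_add2r (\sum_(c0 <- rem c cs) \sum_(x <- c0) e x)) -eqr leq_add2l.
  rewrite big_seq [X in (_ <= X)%N]big_seq; apply: leq_sum => c' /mem_rem.
  exact: le_c.
(* A head occurring below the top of a column would be repeated in [flatten cs]. *)
have nhead c x h : h :: c \in cs -> x \in c -> x \notin heads.
  move=> hcs xc; apply/negP=> xh.
  have : some x \in map ohead cs by rewrite headsE map_f.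
  case/mapP=> -[//|y c' ycs [eqxy]].
  have [eqyh _] : y :: c' = h :: c.
    apply: (flatten_uniq_mem ucs ycs hcs (x := x)); rewrite inE ?eqxy ?eqxx //.
    by rewrite -eqxy xc orbT.
  by have := uc _ hcs; rewrite /= -eqyh -eqxy xc.
apply/mnmP => x; have /flattenP[c ccs] : x \in flatten cs by rewrite allcs.
case: c ccs => // h c hcs; rewrite inE => /predU1P[->|xc]; last first.
  exact/eqw/(nhead c x h).
have := eq_c _ hcs; rewrite !big_cons.
rewrite (eq_big_seq e) => [/addIn //|y yc].
exact/eqw/(nhead c y h).
Qed.

End Columns.

(** * Columns of a tableau whose shape is a conjugate partition *)

Section Tableaux.
Variable n : nat.
Implicit Types (T : tableau n) (lam : seq nat).

Lemma ohead_columns T : map ohead (columns T) = map some (head [::] T).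
Proof.
case: T => // row T; rewrite /columns -map_comp /=.
apply: (@eq_from_nth _ None); rewrite !size_map size_iota // => j ltj.
rewrite (nth_map 0%N) ?size_iota // nth_iota //= add0n.
case: row ltj => // x0 row ltj; rewrite (nth_map x0) //.
by rewrite onthE (nth_map x0).
Qed.

Lemma perm_flatten_columns T :
  all (fun row => size row <= size (head [::] T))%N T ->
  perm_eq (flatten (columns T)) (flatten T).
Proof.
(* The number of columns is detached from the first row, so that the induction can remove rows. *)
rewrite /columns; move: (size _) => h; elim: T => [_|row T IH] /=.
  by elim: (iota 0 h).
case/andP=> le_row /IH {}IH.
(* A new row puts its j-th entry, if any, on top of the j-th column; collected over j, these entries
   give back the row. *)
rewrite (perm_trans (_ : perm_eq _ (pmap (onth row) (iota 0 h)
    ++ flatten [seq pmap (fun row => onth row j) T | j <- iota 0 h]))) //.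
  elim: (iota 0 h) => //= j js IHj; case: (onth row j) => [x|] /=.
    by rewrite perm_cons perm_sym perm_catCA perm_cat2l perm_sym.
  by rewrite perm_sym perm_catCA perm_cat2l perm_sym.
suff -> : pmap (onth row) (iota 0 h) = row by rewrite perm_cat2l.
rewrite -(subnKC le_row) iotaD pmap_cat add0n.
rewrite [X in _ ++ X](_ : _ = [::]) ?cats0; last first.
  apply/eqP; rewrite -size_eq0 size_pmap eqn0Ngt -has_count; apply/hasPn=> j.
  by rewrite mem_iota onthTE => /andP[le_j _]; rewrite -leqNgt.
elim: row {le_row IH} => //= x row IHr; congr (_ :: _).
by rewrite -[in RHS]IHr -[1%N]add1n iotaDl; elim: (iota _ _) => //= j js ->.
Qed.

(** Conjugation is an involution on partitions: both taking columns of [T] and [conj_part] transpose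
    the diagram. *)
Lemma size_columns T lam :
  is_part lam -> shape T = conj_part lam -> map size (columns T) = lam.
Proof.
case/andP=> srt lam0 shT.
have szh : size (head [::] T) = size lam.
  have := congr1 (head 0%N) shT; case: lam lam0 {srt shT} => [|x lam] lam0.
    by case: T.
  rewrite /conj_part; case: x lam0 => //= x lam0.
  rewrite (_ : head 0%N (shape T) = size (head [::] T)); last by case: T.
  move=> ->; rewrite add1n; congr _.+1; apply/eqP; rewrite -all_count.
  by apply/allP => -[|//]; move: lam0; rewrite inE /= => /negP.
rewrite /columns szh -map_comp.
apply: (@eq_from_nth _ 0%N); rewrite size_map size_iota // => j ltj.
rewrite (nth_map 0%N) ?size_iota // nth_iota //= add0n size_pmap.
rewrite (eq_count (a2 := preim size (fun s => j < s)%N)); last first.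
  by move=> row /=; rewrite onthTE.
rewrite -count_map -/(shape T) shT /conj_part count_map.
have gt : transitive geq by move=> a b c /= ha hc; apply: leq_trans hc ha.
(* Since [lam] is non-increasing, more than j parts exceed i exactly when the part of index j
   exceeds i. *)
rewrite (eq_count (a2 := fun i => i < nth 0%N lam j)%N); last first.
  move=> i /=.
  rewrite -{1}(cat_take_drop j lam) count_cat.
  have ltd : (0 < size (drop j lam))%N by rewrite size_drop subn_gt0.
  have ge_nth a b : (a <= b)%N -> (b < size lam)%N -> (nth 0 lam b <= nth 0 lam a)%N.
    by move=> le_ab lt_b; apply: (sorted_leq_nth gt leqnn 0%N srt); rewrite ?inE //;
      apply: leq_ltn_trans lt_b.
  case: (ltnP i (nth 0 lam j)) => lti.
    rewrite (_ : count _ (take j lam) = j).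
      rewrite -[X in (X < _)%N]addn0 ltn_add2l (drop_nth 0%N) //= lti //.
    rewrite -[RHS](size_takel (ltnW ltj)); apply/eqP; rewrite -all_count.
    apply/(all_nthP 0%N) => a; rewrite size_takel ?(ltnW ltj) // => lta.
    by rewrite nth_take //; apply: leq_trans lti _; apply: ge_nth => //; apply: ltnW.
  rewrite (_ : count _ (drop j lam) = 0%N).
    rewrite addn0 ltnNge (leq_trans (count_size _ _)) //.
    by rewrite size_takel // ltnW.
  apply/eqP; rewrite eqn0Ngt -has_count; apply/hasPn => y /(nthP 0%N)[a].
  rewrite size_drop => lta <-; rewrite nth_drop -leqNgt; apply: leq_trans lti.
  by apply: ge_nth; rewrite ?leq_addr // -ltn_subRL.
have le : (nth 0 lam j <= head 0 lam)%N.
  rewrite -nth0; apply: (sorted_leq_nth gt leqnn 0%N srt); rewrite ?inE //.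
  exact: leq_ltn_trans ltj.
rewrite -(subnKC le) iotaD count_cat add0n.
rewrite (eq_in_count (a2 := xpredT)); last first.
  by move=> i; rewrite mem_iota add0n => /andP[_ /= ->].
rewrite [X in (_ + X)%N](eq_in_count (a2 := xpred0)); last first.
  by move=> i; rewrite mem_iota => /andP[/leq_gtF /= ->].
by rewrite count_predT count_pred0 size_iota addn0.
Qed.

End Tableaux.

(* U is the support of m and V the set of variables of P_d; Z collects the
   variables sent to the singleton columns. *)
Lemma ex_padding (T : finType) (U V : {set T}) t :
  (#|V :\: U| <= t)%N -> (t + #|U| <= #|T|)%N ->
  exists Z : seq T, [/\ uniq Z, size Z = t, {subset V :\: U <= Z}
                      & {in Z, forall x, x \notin U}].
Proof.
(* Listing [V :\: U] first makes every long enough prefix contain it. *)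
move=> leVt let_; pose Z := enum (V :\: U) ++ enum (~: (V :|: U)).
have uZ : uniq Z.
  rewrite cat_uniq !enum_uniq andbT /=; apply/hasPn=> x.
  by rewrite !mem_enum !inE; case: (x \in V); case: (x \in U).
have ZU x : x \in Z = (x \notin U).
  by rewrite mem_cat !mem_enum !inE; case: (x \in V); case: (x \in U).
have sZ : size Z = (#|T| - #|U|)%N.
  rewrite -[(_ - _)%N](addKn #|U|) -{1}(cardsC U) addKn.
  by rewrite -(card_uniqP uZ) addKn; apply: eq_card => x; rewrite ZU inE.
exists (take t Z); split.
- exact: take_uniq.
- by rewrite size_takel // sZ leq_subRL ?max_card // addnC.
- move=> x xV; rewrite take_cat -cardE ltnNge leVt /= mem_cat.
  by rewrite mem_enum xV.
- by move=> x /mem_take; rewrite ZU.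
Qed.

(** * Antisymmetrisation and parity projection inside an invariant ideal *)

Section IdealClosure.
Variables (K : fieldType) (n : nat) (I : {mpoly K[n]} -> Prop).
Hypotheses (idealI : is_ideal I) (invI : Bn_invariant I).

Lemma ideal_mull a f : I f -> I (a * f).
Proof. by case: idealI => _ _; apply. Qed.

Lemma ideal_scale (a : K) f : I f -> I (a *: f).
Proof. by rewrite -mul_mpolyC; apply: ideal_mull. Qed.

Lemma ideal_sum (T : Type) (s : seq T) (F : T -> {mpoly K[n]}) :
  (forall t, I (F t)) -> I (\sum_(t <- s) F t).
Proof. by case: idealI => I0 ID _ IF; apply: big_ind. Qed.

(** A generalised Vandermonde determinant: by the Leibniz formula, the antisymmetrisation over [c]
    of the monomial with exponents [w]. *)
Definition alternant (c : seq 'I_n) (w : 'I_n -> nat) : {mpoly K[n]} :=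
  \det (\matrix_(i < size c, j < size c)
    'X_(tnth (in_tuple c) j) ^+ w (tnth (in_tuple c) i)).

Let act (s : 'S_n) (f : {mpoly K[n]}) := signed_act s [ffun=> false] f.

Lemma act_var s (i : 'I_n) : act s 'X_i = 'X_(s i).
Proof.
by rewrite /act /signed_act comp_mpolyXU -tnth_nth tnth_mktuple ffunE mul1r.
Qed.

Lemma act_prod (s : 'S_n) (T : Type) (r : seq T) (Q : pred T)
    (F : T -> {mpoly K[n]}) :
  act s (\prod_(i <- r | Q i) F i) = \prod_(i <- r | Q i) act s (F i).
Proof. exact: rmorph_prod. Qed.

Lemma act_varX s i k : act s ('X_i ^+ k) = 'X_(s i) ^+ k.
Proof. by rewrite -act_var /act /signed_act rmorphXn. Qed.

Lemma alternant_fixed (s : 'S_n) (c : seq 'I_n) w :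
  (forall x, x \in c -> s x = x) -> act s (alternant c w) = alternant c w.
Proof.
move=> fixc; rewrite /act /signed_act /alternant -det_map_mx; congr (\det _).
apply/matrixP=> i j; rewrite !mxE.
by rewrite [LHS](act_varX s) fixc // mem_tnth.
Qed.

(** Take the signed sum of the images of the polynomial under the permutations of [c]. The cofactors
    [E j] are fixed and come out, leaving the Leibniz formula. *)
Lemma ideal_alternate_column (c : seq 'I_n) (J : Type) (js : seq J) (a : J -> K)
    (E : J -> {mpoly K[n]}) (w : J -> 'I_n -> nat) :
  uniq c ->
  (forall s : 'S_n, (forall x, x \notin c -> s x = x) ->
     forall j, act s (E j) = E j) ->
  I (\sum_(j <- js) a j *: (E j * \prod_(x <- c) 'X_x ^+ w j x)) ->
  I (\sum_(j <- js) a j *: (E j * alternant c (w j))).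
Proof.
move=> uc Efix If.
(* Each permutation of the positions of [c] lifts to a permutation of the variables that is the
   identity off [c]. *)
have /fin_all_exists2[sigma sigma_fix sigmaE] (t : 'S_(size c)) :
    exists2 s : 'S_n, forall x, x \notin c -> s x = x
      & forall i, s (tnth (in_tuple c) i) = tnth (in_tuple c) (t i).
  pose b := [seq tnth (in_tuple c) (t i) | i <- enum 'I_(size c)].
  have cE : c = [seq tnth (in_tuple c) i | i <- enum 'I_(size c)].
    by rewrite map_tnth_enum.
  have ub : uniq b.
    rewrite map_inj_uniq ?enum_uniq // => i j.
    by move=> /(tuple_uniqP (in_tuple c) uc) /perm_inj.
  have [|s [sE sfix]] := perm_map_seq uc ub; first by rewrite size_map size_enum_ord.
  exists s.
    apply: sfix => x; rewrite cE; apply/mapP/mapP=> -[i _ ->].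
      by exists ((t^-1)%g i); rewrite ?mem_enum ?permKV.
    by exists (t i); rewrite ?mem_enum.
  move=> i; move: sE; rewrite {1}cE -map_comp => /eq_in_map.
  by apply; rewrite mem_enum.
have : I (\sum_(t : 'S_(size c)) (-1) ^+ t *
            act (sigma t)
              (\sum_(j <- js) a j *: (E j * \prod_(x <- c) 'X_x ^+ w j x))).
  by apply: ideal_sum => t; apply: ideal_mull; apply: invI.
congr (I _).
transitivity (\sum_(t : 'S_(size c)) \sum_(j <- js)
    a j *: (E j * ((-1) ^+ t *
      \prod_(i < size c) 'X_(tnth (in_tuple c) (t i)) ^+ w j (tnth (in_tuple c) i)))).
  apply: eq_bigr => t _.
  rewrite {1}/act /signed_act raddf_sum mulr_sumr; apply: eq_bigr => j _ /=.
  rewrite linearZ rmorphM /= -scalerAr mulrCA; congr (_ *: (_ * (_ * _))).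
    exact/Efix/sigma_fix.
  rewrite [LHS](act_prod (sigma t)) [LHS]big_tnth.
  by apply: eq_bigr => i _; rewrite act_varX sigmaE.
rewrite exchange_big; apply: eq_bigr => j _ /=.
rewrite -scaler_sumr -mulr_sumr; congr (_ *: (_ * _)).
by apply: eq_bigr => t _; congr (_ * _); apply: eq_bigr => i _; rewrite mxE.
Qed.

Lemma ideal_alternate (cs : seq (seq 'I_n)) (J : Type) (js : seq J) (a : J -> K)
    (w : J -> 'X_{1..n}) :
  uniq (flatten cs) -> flatten cs =i predT ->
  I (\sum_(j <- js) a j *: 'X_[w j]) ->
  I (\sum_(j <- js) a j *: \prod_(c <- cs) alternant c (w j)).
Proof.
move=> ucs allcs If.
(* The induction antisymmetrises one column at a time; the variables not yet reached keep their
   plain powers. *)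
suff : I (\sum_(j <- js) a j *: (\prod_(c <- cs) alternant c (w j)
           * \prod_(x | x \notin flatten cs) 'X_x ^+ w j x)).
  congr (I _); apply: eq_bigr => j _; rewrite [X in _ * X]big1 ?mulr1 // => x.
  by rewrite allcs.
elim: cs ucs {allcs} => [_|c cs IH] /=.
  congr (I _): If; apply: eq_bigr => j _.
  by rewrite big_nil mul1r mpolyXE_id.
rewrite cat_uniq => /and3P[uc dis /[dup] ucs /IH {}IH].
suff : I (\sum_(j <- js) a j *: ((\prod_(c <- cs) alternant c (w j)
           * \prod_(x | x \notin c ++ flatten cs) 'X_x ^+ w j x)
           * alternant c (w j))).
  by congr (I _); apply: eq_bigr => j _; rewrite big_cons -[in RHS]mulrA [in RHS]mulrC.
apply: ideal_alternate_column => // [s sfix j|].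
  rewrite {1}/act /signed_act rmorphM /=; congr (_ * _).
    rewrite [LHS](act_prod s) big_seq [RHS]big_seq.
    apply: eq_bigr => c' c'cs; apply: alternant_fixed => x xc'.
    apply: sfix; apply: contra dis => xc; apply/hasP; exists x => //.
    by apply/flattenP; exists c'.
  rewrite [LHS](act_prod s); apply: eq_bigr => x.
  by rewrite mem_cat negb_or => /andP[xc _]; rewrite act_varX sfix.
congr (I _): IH; apply: eq_bigr => j _; rewrite -mulrA; congr (_ *: (_ * _)).
rewrite (bigID (mem c)) /= mulrC; congr (_ * _).
  by apply: eq_bigl => x; rewrite mem_cat negb_or andbC.
rewrite big_uniq //; apply: eq_bigl => x; rewrite andbC.
case xc: (x \in c) => //=; apply: contra dis => xcs; apply/hasP.
by exists x.
Qed.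

Lemma ideal_mperm (s : 'S_n) (J : Type) (js : seq J) (a : J -> K)
    (w : J -> 'X_{1..n}) :
  I (\sum_(j <- js) a j *: 'X_[w j]) ->
  I (\sum_(j <- js) a j *: 'X_[[multinom w j ((s^-1)%g i) | i < n]]).
Proof.
move/(invI s [ffun=> false]); congr (I _).
rewrite /signed_act raddf_sum; apply: eq_bigr => j _ /=.
rewrite linearZ /= comp_mpolyX mpolyXE_id [in RHS](reindex_inj (@perm_inj _ s)).
congr (_ *: _); apply: eq_bigr => i _.
by rewrite tnth_mktuple ffunE mul1r mnmE permK.
Qed.

Lemma ideal_mulX (m : 'X_{1..n}) (J : Type) (js : seq J) (a : J -> K)
    (w : J -> 'X_{1..n}) :
  I (\sum_(j <- js) a j *: 'X_[w j]) ->
  I (\sum_(j <- js) a j *: 'X_[(m + w j)%MM]).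
Proof.
move/(ideal_mull 'X_[m]); congr (I _).
by rewrite mulr_sumr; apply: eq_bigr => j _; rewrite mpolyXD scalerAr.
Qed.

(** Orthogonality of the characters of the group of sign changes: the sum factors over the
    variables, and each factor is 2 or 0. *)
Lemma sum_sign_parity (S : {set 'I_n}) (w : 'I_n -> nat) :
  \sum_(e : {ffun 'I_n -> bool}) \prod_i (-1) ^+ (e i * (i \in S))
      * \prod_i ((-1) ^+ (e i * w i)) =
  (if [forall i, odd (w i) == (i \in S)] then 2%:R ^+ n else 0) :> {mpoly K[n]}.
Proof.
under eq_bigr => e _ do rewrite -big_split /=.
rewrite -(bigA_distr_bigA (fun i (b : bool) =>
  (-1) ^+ (b * (i \in S)) * (-1) ^+ (b * w i))) /=.
under eq_bigr => i _ do rewrite big_bool /= !mul1n !mul0n !mulr1 -signr_odd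
  -[X in _ * X]signr_odd -signr_addb.
case: ifPn => [/forallP wS|/forallPn[i /negPf wi]].
  rewrite -[X in _ = _ ^+ X]card_ord -prodr_const; apply: eq_bigr => i _.
  by rewrite (eqP (wS i)) oddb addbb expr0.
rewrite (bigD1 i) //=.
by case: (odd (w i)) wi; case: (i \in S) => //= _; rewrite expr1 expr0 addNr mul0r.
Qed.

(** Averaging the sign changes against the character attached to [S] projects onto the monomials
    with odd exponents exactly on [S]; the average divides by a power of 2. *)
Lemma ideal_parity (S : {set 'I_n}) (J : Type) (js : seq J) (a : J -> K)
    (w : J -> 'X_{1..n}) :
  2%:R != 0 :> K ->
  I (\sum_(j <- js) a j *: 'X_[w j]) ->
  I (\sum_(j <- js | [forall i, odd (w j i) == (i \in S)]) a j *: 'X_[w j]).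
Proof.
move=> K2 If.
have : I ((2%:R ^- n) *: \sum_(e : {ffun 'I_n -> bool})
    (\prod_i (-1) ^+ (e i * (i \in S)))
      * signed_act 1%g e (\sum_(j <- js) a j *: 'X_[w j])).
  apply/ideal_scale/ideal_sum => e.
  by apply/ideal_mull/invI.
congr (I _).
under eq_bigr => e _ do rewrite /signed_act raddf_sum mulr_sumr.
rewrite exchange_big scaler_sumr [RHS]big_mkcond; apply: eq_bigr => j _ /=.
transitivity ((2%:R ^- n) *: ((if [forall i, odd (w j i) == (i \in S)]
   then 2%:R ^+ n else 0) * (a j *: 'X_[w j]))).
  rewrite -sum_sign_parity mulr_suml; congr (_ *: _); apply: eq_bigr => e _.
  rewrite linearZ /= comp_mpolyX -mulrA; congr (_ * _).
  rewrite mpolyXE_id -scalerAr -big_split /=; congr (_ *: _); apply: eq_bigr => i _.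
  by rewrite tnth_mktuple perm1 exprMn exprM.
case: ifP => _; last by rewrite mul0r scaler0.
have -> : 2%:R ^+ n = (2%:R ^+ n)%:MP :> {mpoly K[n]}.
  by rewrite (rmorphXn (@mpolyC n K)) rmorph_nat.
rewrite -scalerAr mul_mpolyC.
by rewrite !scalerA mulrAC mulVf ?mul1r // expf_neq0.
Qed.

End IdealClosure.

(** * Alternants as Vandermonde determinants *)

Lemma alternant_eq0 (K : fieldType) n (c : seq 'I_n) (w : 'I_n -> nat) x y :
  x \in c -> y \in c -> x != y -> w x = w y -> alternant K c w = 0.
Proof.
move=> /(@tnthP _ _ (in_tuple c))[i ->] /(@tnthP _ _ (in_tuple c))[j ->] neij eqw.
apply: (@determinant_alternate _ _ _ i j) => [|k]; last by rewrite !mxE eqw.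
by apply: contra_neq neij => ->.
Qed.

(* The Vandermonde rows appear in reverse order in the alternant, so the two
   sides agree up to sign. *)
Lemma alternant_Delta (K : fieldType) n (c : seq 'I_n) (w : 'I_n -> nat) (b : bool) :
  uniq c ->
  {in c, forall x, w x = 2 * (size c - (index x c).+1) + b}%N ->
  exists u : {mpoly K[n]},
    Delta c (fun i => 'X_i ^+ 2) * \prod_(x <- c) 'X_x ^+ b
    = u * alternant K c w.
Proof.
move=> uc wE; pose x i : 'I_n := tnth (in_tuple c) i.
pose y : 'rV[{mpoly K[n]}]_(size c) := \row_i 'X_(x i) ^+ 2.
pose p : 'rV[{mpoly K[n]}]_(size c) := \row_i 'X_(x i) ^+ b.
pose rev := perm (@rev_ord_inj (size c)).
(* The matrix is the Vandermonde matrix in the squares with its rows reversed and its columns scaled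
   by the entries of [p]. *)
have -> : alternant K c w
    = (-1) ^+ rev * \det (Vandermonde _ y) * \prod_(x <- c) 'X_x ^+ b.
  rewrite -det_perm -det_mulmx -row_permE [in RHS]big_tnth.
  rewrite (eq_bigr (fun i => p 0 i)) => [|i _]; last by rewrite mxE.
  rewrite -det_diag -det_mulmx; congr (\det _); apply/matrixP=> i j.
  rewrite mul_mx_diag !mxE permE -exprM -exprD wE ?mem_tnth //.
  by rewrite [index _ _](_ : _ = i :> nat) // (tnth_nth (x i)) index_uniq.
(* [Delta] and [det_Vandermonde] take each difference in opposite orders, which costs one sign per
   pair. *)
pose s : {mpoly K[n]} := \prod_(i < size c) \prod_(j < size c | (i < j)%N) -1.
exists (s * (-1) ^+ rev).
rewrite !mulrA; congr (_ * _).
rewrite -[s * _ * _]mulrA -signr_addb addbb mulr1.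
rewrite det_Vandermonde /Delta -big_split; apply: eq_bigr => i _ /=.
rewrite -big_split; apply: eq_bigr => j _ /=.
by rewrite !mxE mulN1r opprB.
Qed.

Lemma prod_alternant_Delta (K : fieldType) n (cs : seq (seq 'I_n)) (w : 'I_n -> nat)
    (b : bool) :
  uniq (flatten cs) ->
  {in cs, forall c, {in c, forall x,
     w x = 2 * (size c - (index x c).+1) + b}}%N ->
  exists u : {mpoly K[n]},
    \prod_(c <- cs) Delta c (fun i => 'X_i ^+ 2)
      * \prod_(x <- flatten cs) 'X_x ^+ b
    = u * \prod_(c <- cs) alternant K c w.
Proof.
elim: cs => [_ _|c cs IH /=]; first by exists 1; rewrite !big_nil.
rewrite cat_uniq => /and3P[uc _ ucs] wE.
have [c' c'cs|v Ev] := IH ucs; first by apply: wE; rewrite inE c'cs orbT.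
have [|u Eu] := alternant_Delta K uc (b := b) (w := w); first exact/wE/mem_head.
by exists (u * v); rewrite !big_cons big_cat /= mulrACA Eu Ev mulrACA.
Qed.

Lemma msupp_pihomog (K : fieldType) n d (p : {mpoly K[n]}) u :
  (u \in msupp (pihomog mdeg d p)) = (mdeg u == d) && (u \in msupp p).
Proof.
rewrite pihomogE -big_filter (perm_mem (msupp_sumX _ _)) ?mem_filter //.
  by rewrite filter_uniq // msupp_uniq.
by move=> v; rewrite mem_filter mcoeff_msupp => /andP[].
Qed.

(** * Exponents at the heads of the columns *)

Section BitableauColumns.
Variable n : nat.
Implicit Types (T : tableau n) (lam : seq nat).

Lemma perm_flatten_columns_conj T lam :
  shape T = conj_part lam -> perm_eq (flatten (columns T)) (flatten T).
Proof.
move=> shT; apply: perm_flatten_columns.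
have /andP[] := conj_part_is_part lam; rewrite -shT => srt _.
have gt : transitive geq by move=> a b c /= ha hc; apply: leq_trans hc ha.
case: T srt {shT} => //= row T /(order_path_min gt).
by rewrite leqnn all_map.
Qed.

(** A head has index 0, so its exponent is fixed by the height of its column. For heights [k i + 1]
    and [r i + 1] this gives the exponents of [m]. *)
Lemma head_exponent T lam (e : 'I_n -> nat) (b : bool) :
  map size (columns T) = lam -> 0%N \notin lam ->
  {in columns T, forall c, {in c, forall x,
     e x = 2 * (size c - (index x c).+1) + b}}%N ->
  map e (head [::] T) = [seq (2 * x.-1 + b)%N | x <- lam].
Proof.
move=> <- lam0 eE; apply: (inj_map (f := some)) => [x y [] //|].
transitivity (map (omap e) (map some (head [::] T))).
  by rewrite -!map_comp.
rewrite -ohead_columns; move: (columns T) lam0 eE => cs lam0 eE.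
rewrite -!map_comp; apply/eq_in_map => -[|h c] hc /=.
  by case/negP: lam0; apply/mapP; exists [::].
by rewrite (eE _ hc) ?mem_head //= eqxx subSS subn0.
Qed.

End BitableauColumns.

(** * Every Specht polynomial of the given shape lies in the ideal *)

(** [W1] and [W2] list the variables to be renamed to the column heads of the two tableaux, in
    order; they contain all variables of the top-degree part. *)
Lemma ideal_specht (K : fieldType) (n : nat) (I : {mpoly K[n]} -> Prop)
    (lam mu : seq nat) (P : {mpoly K[n]}) (m : 'X_{1..n}) (W1 W2 : seq 'I_n) TS :
  2%:R != 0 :> K -> is_ideal I -> Bn_invariant I -> I P ->
  is_part lam -> is_part mu ->
  m \in msupp P ->
  (forall u, u \in msupp P -> (mdeg u <= mdeg m)%N) ->
  (forall u, u \in msupp P -> mdeg u = mdeg m ->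
     forall i, i \notin W1 ++ W2 -> u i = 0%N) ->
  uniq (W1 ++ W2) ->
  map m W1 = [seq (2 * x.-1)%N | x <- lam] ->
  map m W2 = [seq (2 * x.-1 + 1)%N | x <- mu] ->
  is_bitableau (conj_part lam, conj_part mu) TS ->
  I (specht K TS).
Proof.
move=> K2 idealI invI PI lamP muP mP mtop u0 uW mW1 mW2.
case: TS => T1 T2 /and3P[/= /eqP sh1 /eqP sh2 permT].
pose S := [set x in flatten T2].
pose cs := columns T1 ++ columns T2.
have perm1 := perm_flatten_columns_conj sh1.
have perm2 := perm_flatten_columns_conj sh2.
have permcs : perm_eq (flatten cs) (enum 'I_n).
  by rewrite flatten_cat (perm_trans _ permT) // perm_cat.
have ucs : uniq (flatten cs) by rewrite (perm_uniq permcs) enum_uniq.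
have allcs : flatten cs =i predT.
  by move=> x; rewrite (perm_mem permcs) mem_enum.
have uT : uniq (flatten T1 ++ flatten T2) by rewrite (perm_uniq permT) enum_uniq.
have inS c x : c \in cs -> x \in c -> (x \in S) = (c \in columns T2).
  move=> ccs xc; rewrite inE -(perm_mem perm2); apply/idP/idP.
    case/flattenP=> c' c'T2 xc'.
    by rewrite (flatten_uniq_mem ucs ccs _ xc xc') // mem_cat c'T2 orbT.
  by move=> cT2; apply/flattenP; exists c.
have [e eE] := ex_column_exponent S ucs.
pose heads := head [::] T1 ++ head [::] T2.
have headsE : map ohead cs = map some heads.
  by rewrite !map_cat !ohead_columns.
have uheads : uniq heads.
  apply: subseq_uniq uT; apply: cat_subseq; rewrite /flatten.
    by case: (T1) => //= *; apply: prefix_subseq.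
  by case: (T2) => //= *; apply: prefix_subseq.
have eT1 : {in columns T1, forall c, {in c, forall x,
    e x = 2 * (size c - (index x c).+1) + false}}%N.
  move=> c c1 x xc; have ccs : c \in cs by rewrite mem_cat c1.
  rewrite (eE _ ccs) // /column_exponent; congr (_ + nat_of_bool _)%N.
  rewrite inE -(perm_mem perm2); apply/negP => x2.
  move: ucs; rewrite flatten_cat cat_uniq => /and3P[_ /hasPn dis _].
  by case/negP: (dis x x2); apply/flattenP; exists c.
have eT2 : {in columns T2, forall c, {in c, forall x,
    e x = 2 * (size c - (index x c).+1) + true}}%N.
  move=> c c2 x xc; have ccs : c \in cs by rewrite mem_cat c2 orbT.
  by rewrite (eE _ ccs) // /column_exponent (inS c) // c2.
have mW : map m (W1 ++ W2) = map e heads.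
  have [/andP[_ lam0] /andP[_ mu0]] := (lamP, muP).
  rewrite !map_cat mW1 mW2 (head_exponent (size_columns lamP sh1) lam0 eT1).
  rewrite (head_exponent (size_columns muP sh2) mu0 eT2).
  by congr (_ ++ _); apply: eq_map => x; rewrite addn0.
have szW : size (W1 ++ W2) = size heads by rewrite -(size_map m) mW size_map.
have [s [sW _]] := perm_map_seq uW uheads szW.
have sheads x : (x \in heads) = ((s^-1)%g x \in W1 ++ W2).
  by rewrite -sW -{1}(permKV s x) mem_map //; apply: perm_inj.
(* The multiplier supplies [e] off the heads; the renamed [m] supplies it on the heads, so that
   [w m = e]. *)
pose M := [multinom if x \in heads then 0%N else e x | x < n].
pose w (u : 'X_{1..n}) := (M + [multinom u ((s^-1)%g i) | i < n])%MM.
have wE u x : w u x = ((if x \in heads then 0 else e x) + u ((s^-1)%g x))%N.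
  by rewrite mnmDE !mnmE.
have wm : w m = e.
  apply/mnmP => x; rewrite wE sheads; case: ifPn => xW; last first.
    by rewrite (u0 m) // addn0.
  move: mW; rewrite -sW -map_comp => /eq_in_map /(_ _ xW) /=.
  by rewrite permKV.
have wdeg (u : 'X_{1..n}) : mdeg (w u) = (mdeg M + mdeg u)%N.
  by rewrite mdegD mdeg_mperm.
have If : I (\sum_(u <- msupp P) P@_u *: 'X_[w u]).
  apply: (ideal_mulX idealI); apply: (ideal_mperm invI).
  by rewrite -mpolyE.
move/(ideal_parity idealI invI S K2): If; rewrite -big_filter.
move/(ideal_alternate idealI invI ucs allcs).
have oddm : [forall i, odd (w m i) == (i \in S)].
  apply/forallP=> x; have /flattenP[c ccs xc] : x \in flatten cs by rewrite allcs.
  by rewrite wm (eE c) // /column_exponent oddD oddM oddb.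
rewrite (bigD1_seq m) /=; first last.
- by rewrite filter_uniq ?msupp_uniq.
- by rewrite mem_filter oddm.
(* If [w u] were injective on every column, minimality would give [w u = e = w m], hence [u = m]. So
   some column repeats an exponent and its alternant vanishes. *)
rewrite [X in _ + X]big1_seq ?addr0 => [|u]; last first.
  rewrite mem_filter => /and3P[num /forallP oddu uP].
  have /allPn[c ccs /allPn[x xc /allPn[y yc]]] :
      ~~ all (fun c => all (fun x => all (fun y =>
        (w u x == w u y) ==> (x == y)) c) c) cs.
    apply: contra num => /allP winj.
    suff weq : w u = e.
      apply/eqP/mnmP => x; move/mnmP/(_ (s x)): weq; rewrite -wm !wE permK.
      exact: addnI.
    apply: (column_exponent_min ucs allcs headsE eE).
    - by move=> x; rewrite (eqP (oddu x)).
    - move=> c ccs x y xc yc /eqP.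
      by have /allP/(_ _ xc)/allP/(_ _ yc)/implyP wxy := winj c ccs => /wxy/eqP.
    - by move=> c ccs x y xc yc; rewrite !(inS c).
    - by rewrite -wm !wdeg leq_add2l mtop.
    (* Now [u] has the degree of [m], so both vanish outside [W1 ++ W2], and off the heads only [M]
       contributes. *)
    rewrite -wm !wdeg => /addnI degu x xh.
    have xW : (s^-1)%g x \notin W1 ++ W2 by rewrite -sheads.
    by rewrite !wE (u0 u) // (u0 m).
  rewrite negb_imply => /andP[/eqP eqw neq].
  by rewrite (big_rem c ccs) /= (alternant_eq0 K xc yc neq eqw) mul0r scaler0.
move/(ideal_scale idealI (P@_m)^-1); rewrite scalerA mulVf -?mcoeff_msupp // scale1r.
rewrite wm big_cat /=.
move: ucs; rewrite flatten_cat cat_uniq => /and3P[ucs1 _ ucs2].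
have [u1 E1] := prod_alternant_Delta K ucs1 eT1.
have [u2 E2] := prod_alternant_Delta K ucs2 eT2.
move/(ideal_mull idealI (u1 * u2)); rewrite mulrACA -E1 -E2; congr (I _).
(* The first tableau contributes zeroth powers of its variables, the second the factor ['X_i] for
   each entry. *)
rewrite [X in _ * X * _]big1 // mulr1 mulrA; congr (_ * _).
by rewrite (perm_big _ perm2).
Qed.

(** * From the factorisation of [m] to the lists of head variables *)

Lemma mpolyX_inj (R : nzRingType) n : injective (@mpolyX n R).
Proof.
move=> u v /(congr1 (mcoeff u)); rewrite !mcoeffX eqxx.
by case: eqP => // _ /eqP; rewrite oner_eq0.
Qed.

Theorem theorem7 (K : fieldType) (charK : [pchar K] =i pred0) (n : nat)
    (I : {mpoly K[n]} -> Prop) (idealI : is_ideal I) (invI : Bn_invariant I)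
    (P : {mpoly K[n]}) (PI : I P)
    (m : 'X_{1..n}) (mP : m \in msupp (top_homog P))
    (I1 I2 : {set 'I_n}) (k r : 'I_n -> nat)
    (disjI : I1 :&: I2 = set0)
    (k_ge1 : forall i, i \in I1 -> (1 <= k i)%N)
    (defm : 'X_[K, m] = \prod_(i in I1) 'X_i ^+ (2 * k i)
                        * \prod_(i in I2) 'X_i ^+ (2 * r i + 1))
    (wtP : (wt (top_homog P) + \sum_(i in I1) k i + \sum_(i in I2) r i <= n)%N) :
  forall f : {mpoly K[n]}, specht_ideal (Gamma_star I1 I2 k r) f -> I f.
Proof.
have K2 : 2%:R != 0 :> K.
  by apply/negP=> K2; have := charK 2; rewrite inE /= K2.
have I12 i : i \in I1 -> i \notin I2.
  by move=> i1; apply/negP=> i2; have := in_set0 i; rewrite -disjI inE i1 i2.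
(* Exponents are read off the factorisation by injectivity of monomials. *)
have mE i : m i = ((if i \in I1 then 2 * k i else 0)
                  + (if i \in I2 then 2 * r i + 1 else 0))%N.
  pose m' := [multinom ((if i \in I1 then 2 * k i else 0)
                  + (if i \in I2 then 2 * r i + 1 else 0))%N | i < n].
  suff -> : m = m' by rewrite mnmE.
  apply: (@mpolyX_inj K); rewrite defm [RHS]mpolyXE_id.
  rewrite [X in X * _]big_mkcond [X in _ * X]big_mkcond -big_split.
  apply: eq_bigr => j _ /=; rewrite mnmE.
  by case: ifP; case: ifP; rewrite ?mulr1 ?mul1r -?exprD ?addn0 ?add0n.
have m_eq0 i : (m i == 0)%N = (i \notin I1 :|: I2).
  rewrite mE inE; case i1: (i \in I1) => /=.
    by rewrite addn_eq0 muln_eq0 /= eqn0Ngt k_ge1.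
  by case: (i \in I2) => //=; rewrite addn1.
have supp_top u : (u \in msupp (top_homog P))
    = (mdeg u == (msize P).-1) && (u \in msupp P) by apply: msupp_pihomog.
have [/eqP degm mPP] := andP (etrans (esym (supp_top m)) mP).
pose U := I1 :|: I2.
have cardU : #|U| = (#|I1| + #|I2|)%N by rewrite cardsU disjI cards0 subn0.
pose V := [set i : 'I_n |
  has (fun u : 'X_{1..n} => 0 < u i)%N (msupp (top_homog P))].
have subUV : U \subset V.
  apply/subsetP => i iU; rewrite inE; apply/hasP; exists m => //.
  by rewrite lt0n m_eq0 negbK.
(* The number of trailing ones of [lambda_tilde]. The weight hypothesis says that they can absorb
   the variables of the top part missing from [m]. *)
pose t := (n - (#|I1| + #|I2| + \sum_(i in I1) k i + \sum_(i in I2) r i))%N.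
have le_n : (#|I1| + #|I2| + \sum_(i in I1) k i + \sum_(i in I2) r i <= n)%N.
  apply: leq_trans wtP; rewrite -cardU !leq_add2r; exact: subset_leq_card.
have [||Z [uZ szZ subZ ZU]] := @ex_padding _ U V t.
- rewrite cardsD (setIidPr subUV) leq_subLR cardU /t.
  have arith v a b c : (v + b + c <= n -> a + b + c <= n ->
    v <= a + (n - (a + b + c)))%N by lia.
  exact: arith.
- rewrite cardU card_ord /t.
  have arith a b c : (a + b + c <= n -> n - (a + b + c) + a <= n)%N by lia.
  exact: arith.
(* Sorting by [k] and by [r] follows the order of the parts; [Z], where [m] has exponent 0, matches
   the trailing ones. *)
pose W1 := sort (relpre k geq) (enum I1) ++ Z.
pose W2 := sort (relpre r geq) (enum I2).
have memW i : (i \in W1 ++ W2) = (i \in U) || (i \in Z).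
  by rewrite !mem_cat !mem_sort !mem_enum inE orbAC.
have part1 : is_part (lambda_tilde I1 I2 k r).
  by apply/is_part_succ/sort_sorted => x y; apply: leq_total.
have part2 : is_part (mu_tilde I2 r).
  rewrite /mu_tilde -[map _ _]cats0.
  by apply/(is_part_succ 0)/sort_sorted => x y; apply: leq_total.
move=> f; apply=> // g [TS shTS ->].
apply: (ideal_specht K2 idealI invI PI part1 part2 mPP _ _ _ _ _ shTS
  (W1 := W1) (W2 := W2)).
- by move=> u /msize_mdeg_lt; rewrite degm; case: (msize P).
- move=> u uP degu i; rewrite memW negb_or => /andP[iU iZ].
  apply/eqP; rewrite eqn0Ngt; apply: contra iZ => ui.
  apply: subZ; rewrite inE iU inE; apply/hasP; exists u => //.
  by rewrite supp_top degu degm eqxx.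
- rewrite !cat_uniq !sort_uniq !enum_uniq uZ !andbT /=.
  apply/andP; split; apply/hasPn => x.
    by move=> /ZU; rewrite inE negb_or mem_sort mem_enum => /andP[].
  rewrite mem_sort mem_enum mem_cat mem_sort mem_enum => x2.
  rewrite negb_or (contraL (@I12 x)) //=.
  by apply/negP => /ZU; rewrite inE x2 orbT.
- rewrite /W1 /lambda_tilde !map_cat -map_comp sort_map -map_comp; congr (_ ++ _).
    apply/eq_in_map => i; rewrite mem_sort mem_enum => i1 /=.
    by rewrite mE i1 (negPf (I12 _ i1)) addn0.
  rewrite map_nseq -[(n - _)%N]/t -szZ -(size_map m); apply/all_pred1P; rewrite all_map.
  by apply/allP => i /ZU iU; rewrite /= m_eq0.
- rewrite /W2 /mu_tilde sort_map -!map_comp.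
  apply/eq_in_map => i; rewrite mem_sort mem_enum => i2 /=.
  by rewrite mE i2 (contraTF (@I12 i)) ?i2.
Qed.
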